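(* For every $\sigma\in\{-1,1\}^d$ such that $\sigma_{d-1}=\sigma_d=1$, let $\mathbf{q}_\sigma$ and $\mathbf{p}_\sigma^{(\delta)}$ be as defined below. Then for sufficiently small $\delta:=1/L>0$, the following two statements hold. \begin{itemize} \item[(i)] The pair $(\mathbf{p}_\sigma^{(\delta)},\mathbf{q}_\sigma)$ is the unique optimal solution of the SVM optimization problem \[ \begin{array}{ll} \mathrm{minimize}_{\mathbf{p},\mathbf{q}} & \|\mathbf{p}-\mathbf{q}\|^2 \\ \mathrm{subject~to} & \mathbf{p}\in\mathrm{conv}_{\mu(\mathbf{q}_\sigma)} \left(\mathcal{P}^+\right) \\ & \mathbf{q}\in\mathrm{conv}_{\mu(\mathbf{q}_\sigma)} \left(\mathcal{P}^-\right). \end{array} \] \item[(ii)] When considering the optimal solution to the dual SVM problem (minimize $\sum_{i,j}\alpha_i\alpha_jy_iy_j\mathbf{p}_i^T\mathbf{p}_j$ subject to $\sum_{i:y_i=+1}\alpha_i=1$, $\sum_{i:y_i=-1}\alpha_i=1$, $0\le\alpha_i\le\mu$, with $\mathcal{P}^+$ labelled $+1$ and $\mathcal{P}^-$ labelled $-1$) for the regularization parameter value $\mu=\mu(\mathbf{q}_\sigma)$, the support vectors corresponding to the first point class $\mathcal{P}^+$ are uniquely determined, and given by the $d$ vectors \[ \{\mathbf{w}_{(k,\sigma_k)}(L) : k \in \{1,\dots,d\}\} , \] which is a different set for every single one of the $2^d/4$ many possible $\sigma$. \end{itemize}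
   Context: Fix $\epsilon,\gamma$ with $0<4\gamma<\epsilon<\frac12$. The Goldfarb cube $\mathrm{Gol}_d\subseteq\mathbb{R}^d$ is the set of $\mathbf{x}$ with $-z_1\le x_1\le z_1:=1$, $-z_2\le x_2\le z_2:=1-\epsilon-\epsilon x_1$, $-z_k\le x_k\le z_k:=1-\epsilon+\epsilon\gamma-\epsilon(x_{k-1}-\gamma x_{k-2})$ ($3\le k\le d$). Its vertices are $\mathbf{v}_\sigma$, $\sigma\in\{-1,1\}^d$ (for each $k$, $x_k=z_k$ is tight if $\sigma_k=1$, $x_k=-z_k$ if $\sigma_k=-1$), with $\mathrm{sign}(v_{\sigma,k})=\sigma_k$. For $(k,s)\in\{1,\ldots,d\}\times\{-1,1\}$, $\mathbf{w}_{(k,s)}$ is the unique vector such that the inequality $-z_k\le x_k$ (for $s=-1$) resp.\ $x_k\le z_k$ (for $s=1$) reads $\mathbf{w}_{(k,s)}^T\mathbf{x}\le1$; these $2d$ vectors are the vertices of the dual Goldfarb cube $\mathrm{Gol}^{\triangle}_d=\bigcap_\tau\{\mathbf{x}:\mathbf{v}_\tau^T\mathbf{x}\le1\}$. Let $\mathcal{S}:=\{\mathbf{x}\in\mathbb{R}^d: x_1=\ldots=x_{d-2}=0\}$. For $\mathbf{x}$ and $L\ge0$, $\mathbf{x}(L):=(Lx_1,\ldots,Lx_{d-2},x_{d-1},x_d)$, $\mathcal{P}(L):=\{\mathbf{x}(L):\mathbf{x}\in\mathcal{P}\}$, $\delta=1/L$. For each $\sigma$ there is $\mathbf{p}_\sigma\in\mathcal{S}\cap\mathrm{Gol}^{\triangle}_d$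 with $\mathbf{p}_\sigma^T\mathbf{v}_\sigma=1$ and $\mathbf{p}_\sigma^T\mathbf{v}_\tau<1$ for $\tau\ne\sigma$. Let $\mathcal{L}:=\{(0,\ldots,0,2,y)^T:y\in\mathbb{R}\}$. Define $\mathbf{q}_\sigma:=\mathbf{p}_\sigma-C\,\mathbf{v}_\sigma(0)/\|\mathbf{v}_\sigma(0)\|^2$ with $C<0$ chosen so $q_{\sigma,d-1}=2$, and $\mathbf{p}_\sigma^{(\delta)}:=C\,\mathbf{v}_\sigma(\delta)/\|\mathbf{v}_\sigma(\delta)\|^2+\mathbf{q}_\sigma$ (projection of $\mathbf{q}_\sigma$ onto $\mathbf{v}_\sigma(\delta)^T\mathbf{x}=1$). For a finite set $\mathcal{P}$, $\mathrm{conv}_\mu(\mathcal{P}):=\{\sum_p\alpha_p p:0\le\alpha_p\le\mu,\sum_p\alpha_p=1\}$. The first point class is $\mathcal{P}^+:=\{\mathbf{w}_{(k,s)}(L)\}$, so $\mathrm{conv}(\mathcal{P}^+)=\mathrm{Gol}^{\triangle}_d(L)$. Each $\mathbf{p}_\sigma^{(\delta)}$ ($\sigma_{d-1}=\sigma_d=1$) is a unique convex combination of $\mathbf{w}_{(k,\sigma_k)}(L)$, $k=1,\ldots,d$, with positive coefficients whose maximum is $\mu_\sigma^{(\delta)}<1$. Let $\overline{\mu}:=\max\{\frac12,\max_\sigma\mu_\sigma^{(\delta)}\}$, $q_{\min}:=\min_\sigma q_{\sigma,d}$, $q_{\max}:=\max_\sigma q_{\sigma,d}$ (over $\sigma$ with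 $\sigma_{d-1}=\sigma_d=1$). The second class is $\mathcal{P}^-:=\{\mathbf{u}_{\mathrm{left}},\mathbf{u}_{\mathrm{right}}\}$ with $\mathbf{u}_{\mathrm{left}}:=(0,\ldots,0,2,q_{\min})^T$, $\mathbf{u}_{\mathrm{right}}:=(0,\ldots,0,2,q_{\min}+\frac{q_{\max}-q_{\min}}{1-\overline{\mu}})^T$. For $\mathbf{q}\in\mathcal{L}$ with $q_{\min}\le q_d\le q_{\max}$, $\mu(\mathbf{q}):=1-\frac{(q_d-q_{\min})(1-\overline{\mu})}{q_{\max}-q_{\min}}$. *)

(* Defs.v *)
From mathcomp Require Import all_boot all_order all_algebra.
From mathcomp Require Import reals.
Set Implicit Arguments. Unset Strict Implicit. Unset Printing Implicit Defensive.
Import Order.TTheory GRing.Theory Num.Theory.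
Local Open Scope ring_scope.

(* Conventions: vectors of R^d are row vectors 'rV[R]_d; the paper's
   coordinate k (1 <= k <= d) is the ordinal / nat index k-1 here.
   So the paper's coordinates d-1, d are the nat indices d-2, d-1, and the
   paper's first d-2 coordinates are the nat indices j < d-2.
   Sign vectors sigma in {-1,1}^d are {ffun 'I_d -> bool} (true = +1). *)

Definition coord (R : realType) (d : nat) (x : 'rV[R]_d) (j : nat) : R :=
  match (insub j : option 'I_d) with Some k => x 0 k | None => 0 end.

Definition sbit (d : nat) (s : {ffun 'I_d -> bool}) (j : nat) : bool :=
  match (insub j : option 'I_d) with Some k => s k | None => false end.

Definition sgn (R : realType) (b : bool) : R := if b then 1 else -1.

(* upper bound z_i of the Goldfarb cube (0-based i), as a function of
   a = x_{i-1} and b = x_{i-2} (paper: z_1 = 1, z_2 = 1 - eps - eps x_1,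
   z_k = 1 - eps + eps gam - eps (x_{k-1} - gam x_{k-2})). *)
Definition zf (R : realType) (eps gam : R) (i : nat) (a b : R) : R :=
  if i == 0%N then 1
  else if i == 1%N then 1 - eps - eps * a
  else 1 - eps + eps * gam - eps * (a - gam * b).

Definition Gol (R : realType) (d : nat) (eps gam : R) (x : 'rV[R]_d) : Prop :=
  forall k : 'I_d,
    - zf eps gam k (coord x k.-1) (coord x k.-2) <= x 0 k <=
      zf eps gam k (coord x k.-1) (coord x k.-2).

(* Vertex v_sigma: x_k = sigma_k z_k(x) for all k, computed recursively;
   vrec s i = (v_i, v_{i-1}). *)
Fixpoint vrec (R : realType) (eps gam : R) (s : nat -> bool) (i : nat) : R * R :=
  match i with
  | 0%N => (sgn R (s 0%N), 0)
  | i'.+1 => let ab := vrec eps gam s i' in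
             (sgn R (s i) * zf eps gam i ab.1 ab.2, ab.1)
  end.

Definition vtx (R : realType) (d : nat) (eps gam : R) (s : {ffun 'I_d -> bool})
  : 'rV[R]_d := \row_k (vrec eps gam (sbit s) k).1.

Definition zcst (R : realType) (eps gam : R) (i : nat) : R :=
  if i == 0%N then 1 else if i == 1%N then 1 - eps else 1 - eps + eps * gam.

(* w_(k,s): the inequality s x_k <= z_k(x) rewritten as w^T x <= 1, i.e.
   (s x_k + eps x_{k-1} - eps gam x_{k-2}) / zcst_k <= 1 (terms absent for
   small k). *)
Definition wvec (R : realType) (d : nat) (eps gam : R) (k : 'I_d) (s : bool)
  : 'rV[R]_d :=
  \row_j ((sgn R s * (j == k)%:R + eps * (j.+1 == k)%:R
           - eps * gam * (j.+2 == k)%:R) / zcst eps gam k).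

Definition dot (R : realType) (d : nat) (x y : 'rV[R]_d) : R :=
  \sum_j x 0 j * y 0 j.

Definition nrm2 (R : realType) (d : nat) (x : 'rV[R]_d) : R := dot x x.

Definition scaleL (R : realType) (d : nat) (L : R) (x : 'rV[R]_d) : 'rV[R]_d :=
  \row_j (if (j < d - 2)%N then L * x 0 j else x 0 j).

Definition inS (R : realType) (d : nat) (x : 'rV[R]_d) : Prop :=
  forall j : 'I_d, (j < d - 2)%N -> x 0 j = 0.

Definition inDual (R : realType) (d : nat) (eps gam : R) (x : 'rV[R]_d) : Prop :=
  forall tau : {ffun 'I_d -> bool}, dot (vtx eps gam tau) x <= 1.

Definition adm (d : nat) (s : {ffun 'I_d -> bool}) : bool :=
  sbit s (d - 2)%N && sbit s (d - 1)%N.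

(* C chosen so that q_{sigma,d-1} = 2 *)
Definition Cc (R : realType) (d : nat) (eps gam : R)
  (p : {ffun 'I_d -> bool} -> 'rV[R]_d) (s : {ffun 'I_d -> bool}) : R :=
  let v0 := scaleL 0 (vtx eps gam s) in
  (coord (p s) (d - 2)%N - 2) * nrm2 v0 / coord v0 (d - 2)%N.

Definition qv (R : realType) (d : nat) (eps gam : R)
  (p : {ffun 'I_d -> bool} -> 'rV[R]_d) (s : {ffun 'I_d -> bool}) : 'rV[R]_d :=
  let v0 := scaleL 0 (vtx eps gam s) in
  p s - (Cc eps gam p s / nrm2 v0) *: v0.

Definition pdelta (R : realType) (d : nat) (eps gam : R)
  (p : {ffun 'I_d -> bool} -> 'rV[R]_d) (L : R) (s : {ffun 'I_d -> bool})
  : 'rV[R]_d :=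
  let vd := scaleL (L^-1) (vtx eps gam s) in
  (Cc eps gam p s / nrm2 vd) *: vd + qv eps gam p s.

Definition Pplus (R : realType) (d : nat) (eps gam L : R) (ks : 'I_d * bool)
  : 'rV[R]_d := scaleL L (wvec eps gam ks.1 ks.2).

(* the unique coefficients of p_sigma^(delta) in terms of the
   w_(k,sigma_k)(L) (rows of the matrix), and their maximum mu_sigma^(delta) *)
Definition Wmat (R : realType) (d : nat) (eps gam L : R) (s : {ffun 'I_d -> bool})
  : 'M[R]_d := \matrix_(k, j) (Pplus eps gam L (k, s k)) 0 j.

Definition coefs (R : realType) (d : nat) (eps gam : R)
  (p : {ffun 'I_d -> bool} -> 'rV[R]_d) (L : R) (s : {ffun 'I_d -> bool})
  : 'rV[R]_d := pdelta eps gam p L s *m invmx (Wmat eps gam L s).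

Definition musig (R : realType) (d : nat) (eps gam : R)
  (p : {ffun 'I_d -> bool} -> 'rV[R]_d) (L : R) (s : {ffun 'I_d -> bool}) : R :=
  \big[Num.max/0]_k coefs eps gam p L s 0 k.

Definition mubar (R : realType) (d : nat) (eps gam : R)
  (p : {ffun 'I_d -> bool} -> 'rV[R]_d) (L : R) : R :=
  Num.max (1 / 2) (\big[Num.max/0]_(s | adm s) musig eps gam p L s).

Definition allone (d : nat) : {ffun 'I_d -> bool} := [ffun => true].

Definition qmin (R : realType) (d : nat) (eps gam : R)
  (p : {ffun 'I_d -> bool} -> 'rV[R]_d) : R :=
  \big[Num.min/coord (qv eps gam p (allone d)) (d - 1)%N]_(s | adm s)
     coord (qv eps gam p s) (d - 1)%N.

Definition qmax (R : realType) (d : nat) (eps gam : R)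
  (p : {ffun 'I_d -> bool} -> 'rV[R]_d) : R :=
  \big[Num.max/coord (qv eps gam p (allone d)) (d - 1)%N]_(s | adm s)
     coord (qv eps gam p s) (d - 1)%N.

Definition lpt (R : realType) (d : nat) (y : R) : 'rV[R]_d :=
  \row_j (if (nat_of_ord j == (d - 2)%N) then 2 else if (nat_of_ord j == (d - 1)%N) then y else 0).

Definition uleft (R : realType) (d : nat) (eps gam : R)
  (p : {ffun 'I_d -> bool} -> 'rV[R]_d) : 'rV[R]_d :=
  lpt d (qmin eps gam p).

Definition uright (R : realType) (d : nat) (eps gam : R)
  (p : {ffun 'I_d -> bool} -> 'rV[R]_d) (L : R) : 'rV[R]_d :=
  lpt d (qmin eps gam p + (qmax eps gam p - qmin eps gam p)
                          / (1 - mubar eps gam p L)).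

Definition Pminus (R : realType) (d : nat) (eps gam : R)
  (p : {ffun 'I_d -> bool} -> 'rV[R]_d) (L : R) (b : bool) : 'rV[R]_d :=
  if b then uright eps gam p L else uleft eps gam p.

Definition muq (R : realType) (d : nat) (eps gam : R)
  (p : {ffun 'I_d -> bool} -> 'rV[R]_d) (L : R) (q : 'rV[R]_d) : R :=
  1 - (coord q (d - 1)%N - qmin eps gam p) * (1 - mubar eps gam p L)
      / (qmax eps gam p - qmin eps gam p).

Definition convmu (R : realType) (d : nat) (I : finType) (mu : R)
  (P : I -> 'rV[R]_d) (x : 'rV[R]_d) : Prop :=
  exists a : I -> R, (forall i, 0 <= a i <= mu) /\ \sum_i a i = 1 /\
                     x = \sum_i a i *: P i.

Definition dpt (R : realType) (d : nat) (eps gam : R)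
  (p : {ffun 'I_d -> bool} -> 'rV[R]_d) (L : R) (i : ('I_d * bool) + bool)
  : 'rV[R]_d :=
  match i with inl ks => Pplus eps gam L ks | inr b => Pminus eps gam p L b end.

Definition dlab (R : realType) (d : nat) (i : ('I_d * bool) + bool) : R :=
  match i with inl _ => 1 | inr _ => -1 end.

Definition dobj (R : realType) (d : nat) (eps gam : R)
  (p : {ffun 'I_d -> bool} -> 'rV[R]_d) (L : R)
  (a : ('I_d * bool) + bool -> R) : R :=
  \sum_i \sum_j a i * a j * @dlab R d i * @dlab R d j
                * dot (dpt eps gam p L i) (dpt eps gam p L j).

Definition dfeas (R : realType) (d : nat) (mu : R)
  (a : ('I_d * bool) + bool -> R) : Prop :=
  \sum_(i | @dlab R d i == 1) a i = 1 /\ \sum_(i | @dlab R d i == -1) a i = 1 /\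
  forall i, 0 <= a i <= mu.

Definition dopt (R : realType) (d : nat) (eps gam : R)
  (p : {ffun 'I_d -> bool} -> 'rV[R]_d) (L mu : R)
  (a : ('I_d * bool) + bool -> R) : Prop :=
  @dfeas R d mu a /\
  forall b, @dfeas R d mu b -> dobj eps gam p L a <= dobj eps gam p L b.

Definition svset (R : realType) (d : nat) (eps gam L : R)
  (s : {ffun 'I_d -> bool}) (x : 'rV[R]_d) : Prop :=
  exists k : 'I_d, x = Pplus eps gam L (k, s k).

(* Main.v *)
Require Import Defs.
From mathcomp Require Import all_boot all_order all_algebra.
From mathcomp Require Import reals.
From mathcomp Require Import ring lra zify.
Import Order.TTheory GRing.Theory Num.Theory.
Local Open Scope ring_scope.

Set Implicit Arguments.
Unset Strict Implicit.
Unset Printing Implicit Defensive.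

(** The hyperplane v_sigma(delta)^T x = 1 supports conv P^+ exactly along the
    simplex of the w_(k,sigma_k)(L), because the slacks z_k of the Goldfarb cube are
    positive.  The point p_sigma^(delta) is the projection of q_sigma on it.  For
    delta = 0 its barycentric coordinates are those of p_sigma, each positive by
    comparing v_sigma with the vertex obtained by flipping one sign; for small
    delta they stay positive, so mubar < 1.  With mu = mu(q_sigma), conv_mu P^- is a
    segment of the line L whose left end is q_sigma, and moving right increases
    the distance to the half-space since v_sigma has a positive last coordinate.
    Hence the optimum is unique; the dual objective is the squared distance of
    the two convex combinations, and complementary slackness gives the support. *)

(** * Positivity for all sufficiently small parameters *)

Section SmallParameter.
Variable R : realType.

Lemma small_sqr_pos (a b : R) : 0 < a ->
  exists2 d0, 0 < d0 & forall e, 0 < e < d0 -> 0 < a + e ^+ 2 * b.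
Proof.
move=> a0; pose c := `|b| + 1.
have b0 : 0 <= `|b| by [].
have c0 : 0 < c by rewrite /c; lra.
(* Below 1, [e ^+ 2 <= e]; below [a / c], [e * c < a]. The 1 added in [c] keeps the quotient
   meaningful when [b] is 0. *)
exists (Num.min 1 (a / c)); first by rewrite lt_min ltr01 divr_gt0.
move=> e /andP[e0]; rewrite lt_min => /andP[e1]; rewrite ltr_pdivlMr // => ec.
have eb : - (e ^+ 2 * b) <= e ^+ 2 * `|b|.
  by rewrite -mulrN ler_wpM2l ?sqr_ge0 // -normrN ler_norm.
have : e ^+ 2 * `|b| <= e * `|b|.
  by rewrite ler_wpM2r // expr2 ger_pMr // ltW.
rewrite /c in ec; nra.
Qed.

Lemma small_forall (I : finType) (P : I -> R -> Prop) :
  (forall i, exists2 d0, 0 < d0 & forall e, 0 < e < d0 -> P i e) ->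
  exists2 d0, 0 < d0 & forall e, 0 < e < d0 -> forall i, P i e.
Proof.
move=> hP.
suff [d0 d0_gt0 hd] : exists2 d0 : R, 0 < d0 &
    forall e, 0 < e < d0 -> forall i, i \in enum I -> P i e.
  by exists d0 => // e he i; apply: hd; rewrite ?mem_enum.
elim: (enum I) => [|i r [d1 d1_gt0 h1]]; first by exists 1.
have [d2 d2_gt0 h2] := hP i.
exists (Num.min d1 d2) => [|e]; first by rewrite lt_min d1_gt0.
rewrite lt_min => /and3P[e0 e1 e2] j; rewrite inE => /predU1P[->|jr].
  by apply: h2; rewrite e0.
by apply: h1; rewrite ?e0.
Qed.

End SmallParameter.

(** * Inner product and partial scaling *)

Section InnerProduct.
Variables (R : realType) (d : nat).
Implicit Types x y v : 'rV[R]_d.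

Lemma dotC x y : dot x y = dot y x.
Proof. by apply: eq_bigr => j _; rewrite mulrC. Qed.

Lemma dotDl x y v : dot (x + y) v = dot x v + dot y v.
Proof. by rewrite -big_split; apply: eq_bigr => j _; rewrite mxE mulrDl. Qed.

Lemma dotZl a x v : dot (a *: x) v = a * dot x v.
Proof. by rewrite mulr_sumr; apply: eq_bigr => j _; rewrite mxE mulrA. Qed.

Lemma dotBl x y v : dot (x - y) v = dot x v - dot y v.
Proof. by rewrite -scaleN1r dotDl dotZl mulN1r. Qed.

Lemma dot_suml (I : finType) (x : I -> 'rV[R]_d) v :
  dot (\sum_i x i) v = \sum_i dot (x i) v.
Proof.
rewrite /dot exchange_big; apply: eq_bigr => j _.
by rewrite summxE mulr_suml.
Qed.

Lemma nrm2D x y : nrm2 (x + y) = nrm2 x + 2 * dot x y + nrm2 y.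
Proof.
rewrite /nrm2 dotDl !(dotC _ (x + y)) !dotDl (dotC y x); ring.
Qed.

Lemma nrm2_gt0 x : x != 0 -> 0 < nrm2 x.
Proof.
move=> x0; have h j : true -> 0 <= x 0 j * x 0 j by rewrite -expr2 sqr_ge0.
rewrite lt_neqAle sumr_ge0 // andbT eq_sym; apply: contra x0 => /eqP.
move=> /(psumr_eq0P h) e; apply/eqP/rowP => j; apply/eqP.
by rewrite mxE -sqrf_eq0 expr2 e.
Qed.

(** As [c < 0], [c *: v] is the point of least norm of the half-space: in [x = c *: v + y] with
    [dot y v <= 0] the cross term is nonnegative and [y] is nonzero. *)
Lemma nrm2_halfspace v x c : c < 0 -> dot x v <= c * nrm2 v -> x != c *: v ->
  nrm2 (c *: v) < nrm2 x.
Proof.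
move=> c0 xv xc; pose y := x - c *: v.
have y0 : 0 < nrm2 y by rewrite nrm2_gt0 // subr_eq0.
have yv : dot y v <= 0 by rewrite dotBl dotZl subr_le0.
have -> : x = c *: v + y by rewrite /y addrC subrK.
rewrite nrm2D dotZl (dotC v); nra.
Qed.

Lemma scaleL_sum L (I : finType) (a : I -> R) (x : I -> 'rV[R]_d) :
  scaleL L (\sum_i a i *: x i) = \sum_i a i *: scaleL L (x i).
Proof.
apply/rowP => j; rewrite !summxE !mxE summxE; case: ifP => jd.
  by rewrite mulr_sumr; apply: eq_bigr => i _; rewrite !mxE jd mulrCA.
by apply: eq_bigr => i _; rewrite !mxE jd.
Qed.

Lemma scaleLK L x : L != 0 -> scaleL L^-1 (scaleL L x) = x.
Proof. by move=> L0; apply/rowP => j; rewrite !mxE; case: ifP => jd; rewrite jd ?mulKf. Qed.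

(** Stretching the dual side by [L] and shrinking the primal side by [L^-1] cancel, so incidences
    survive the scaling. *)
Lemma dot_scaleL L x y : L != 0 -> dot (scaleL L x) (scaleL L^-1 y) = dot x y.
Proof.
by move=> L0; apply: eq_bigr => j _; rewrite !mxE; case: ifP => // _; rewrite mulrACA mulfV ?mul1r.
Qed.

Lemma dot_inS L x y : inS x -> dot x (scaleL L y) = dot x y.
Proof.
move=> xS; apply: eq_bigr => j _; rewrite !mxE; case: ifP => // jd.
by rewrite xS // !mul0r.
Qed.

End InnerProduct.

(** * Vertices of the Goldfarb cube and their slacks *)

Section Goldfarb.
Variables (R : realType) (eps gam : R).
Hypotheses (gam_gt0 : 0 < 4 * gam) (gam_lt : 4 * gam < eps) (eps_lt : eps < 1 / 2).

(** Indexed by all naturals, without reference to a dimension, so that inductions on the index need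
    no bounds. *)
Definition vert (f : nat -> bool) (i : nat) : R := (vrec eps gam f i).1.

(** Where [i.-1] or [i.-2] truncates at 0, [zf] ignores that argument. *)
Definition zval (f : nat -> bool) (i : nat) : R :=
  zf eps gam i (vert f i.-1) (vert f i.-2).

Lemma vertE f i : vert f i = sgn R (f i) * zval f i.
Proof. by case: i => [|[|i]] //=; rewrite /vert /zval /zf /= mulr1. Qed.

Lemma zvalSS f i :
  zval f i.+2 = 1 - eps * ((1 + vert f i.+1) - gam * (1 + vert f i)).
Proof. by rewrite /zval /zf /=; ring. Qed.

(* [|x_k| <= 1] alone does not propagate; the third bound yields
   [gam * (1 + x_i) <= (1 + x_{i+1}) / 2], which keeps [z_{i+2} <= 1]. *)
Lemma vert_bounds f i :
  [/\ 0 <= 1 + vert f i <= 2, 0 <= 1 + vert f i.+1 <= 2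
    & 2 * gam * (1 + vert f i) <= 1 + vert f i.+1].
Proof.
have := gam_gt0; have := gam_lt; have := eps_lt; move=> g3 g2 g1.
elim: i => [|i [b0 b1 b2]].
  rewrite !vertE /zval /zf /= /vert /=.
  by case: (f 0) (f 1) => [] []; rewrite /sgn; split; nra.
have zE := zvalSS f i.
have v2 := vertE f i.+2.
move: b0 b1 b2 zE v2.
set E := 1 + vert f i.+1; set F := 1 + vert f i => /andP[F0 F2] /andP[E0 E2] FE zE v2.
have e1 : E / 2 <= E - gam * F by lra.
have e2 : E - gam * F <= 2 by nra.
have e3 : eps * (E / 2) <= eps * (E - gam * F) by rewrite ler_pM2l //; lra.
have e4 : eps * (E - gam * F) <= eps * 2 by rewrite ler_pM2l //; lra.
have e5 : 4 * gam * E <= eps * E by rewrite ler_wpM2r //; lra.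
have e6 : 0 <= gam * E by rewrite mulr_ge0 //; lra.
have e7 : gam * E <= gam * 2 by rewrite ler_wpM2l //; lra.
rewrite v2; split; first by rewrite E0.
  by case: (f _); rewrite /sgn; lra.
by case: (f _); rewrite /sgn; lra.
Qed.

(** The shifted coordinates [1 + x] lie between 0 and 2, which leaves at least [1 - 2 * eps]. *)
Lemma zval_gt0 f i : 0 < zval f i.
Proof.
have := gam_gt0; have := gam_lt; have := eps_lt; move=> g3 g2 g1.
case: i => [|[|i]]; first by rewrite /zval /zf /=.
  have [/andP[h1 h2] _ _] := vert_bounds f 0.
  by rewrite /zval /zf /=; nra.
have [/andP[h1 h2] /andP[h3 h4] _] := vert_bounds f i.
rewrite zvalSS; have := mulr_ge0 (_ : 0 <= gam) h1.
nra.
Qed.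

Lemma zcst_gt0 i : 0 < zcst eps gam i.
Proof. have := gam_gt0; have := gam_lt; have := eps_lt; move=> g3 g2 g1.
by rewrite /zcst; case: ifP => _; [|case: ifP => _]; nra. Qed.

(** With only minus signs before [i], the earlier coordinates are -1 and the shifts [1 + x] vanish.
    This serves to build a vertex with a chosen coordinate equal to 1. *)
Lemma vert_allm f i : (forall j, (j < i)%N -> f j = false) ->
  zval f i = 1.
Proof.
elim/ltn_ind: i => i IH hf.
have vm j : (j < i)%N -> vert f j = -1.
  move=> ji; rewrite vertE hf // IH //; first by rewrite /sgn mulr1.
  by move=> k kj; apply: hf; apply: ltn_trans ji.
case: i vm {IH hf} => [|[|i]] vm; first by [].
  by rewrite /zval /zf /= vm //; ring.
by rewrite zvalSS !vm //; ring.
Qed.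

(** * Incidences between the vertices of the cube and of its dual *)

Variable d : nat.
Implicit Types s t : {ffun 'I_d -> bool}.

Lemma sbitE s (k : 'I_d) : sbit s k = s k.
Proof. by rewrite /sbit valK. Qed.

Lemma coordE (x : 'rV[R]_d) (k : 'I_d) : Defs.coord x k = x 0 k.
Proof. by rewrite /Defs.coord valK. Qed.

Lemma sum_shift (k : 'I_d) m (f : nat -> R) :
  \sum_(j < d) (j + m == k)%N%:R * f j = if (m <= k)%N then f (k - m)%N else 0.
Proof.
case: leqP => mk; last first.
  apply: big1 => j _; case: eqP => e; last by rewrite mul0r.
  by rewrite -e ltnNge leq_addl in mk.
have kd : (k - m < d)%N by rewrite (leq_ltn_trans (leq_subr _ _)).
rewrite (bigD1 (Ordinal kd)) //= subnK // eqxx mul1r big1 ?addr0 // => j jk.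
case: eqP => e; last by rewrite mul0r.
by case/eqP: jk; apply: val_inj; rewrite /= -e addnK.
Qed.

(** At the vertex [x_k] is [zval] with sign [s k], so the slack of the inequality is 0 or twice
    [zval]; division by [zcst] normalises it. *)
Lemma dot_wvec_vtx (k : 'I_d) b s :
  dot (wvec eps gam k b) (vtx eps gam s) =
  1 - (1 - sgn R b * sgn R (s k)) * (zval (sbit s) k / zcst eps gam k).
Proof.
have z0 := zcst_gt0 k.
have -> : dot (wvec eps gam k b) (vtx eps gam s) =
    (sgn R b * \sum_(j < d) (j + 0 == k)%N%:R * vert (sbit s) j
    + eps * (\sum_(j < d) (j + 1 == k)%N%:R * vert (sbit s) j)
    - eps * gam * (\sum_(j < d) (j + 2 == k)%N%:R * vert (sbit s) j))
    / zcst eps gam k.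
  rewrite !mulr_sumr -big_split -sumrB mulr_suml; apply: eq_bigr => j _ /=.
  by rewrite !mxE addn0 addn1 addn2 -/(vert _ _); ring.
rewrite !sum_shift leq0n subn0 vertE sbitE subn1 subn2.
rewrite -[in LHS]addrA.
have -> : eps * (if (0 < k)%N then vert (sbit s) k.-1 else 0)
    - eps * gam * (if (1 < k)%N then vert (sbit s) k.-2 else 0)
    = zcst eps gam k - zval (sbit s) k.
  by rewrite /zval /zf /zcst; case: (nat_of_ord k) => [|[|i]] /=; ring.
by field; rewrite gt_eqF.
Qed.

Lemma dot_wvec_vtx1 (k : 'I_d) s : dot (wvec eps gam k (s k)) (vtx eps gam s) = 1.
Proof.
by rewrite dot_wvec_vtx; case: (s k); rewrite /sgn; ring.
Qed.

Lemma dot_wvec_vtx_lt1 (k : 'I_d) b s : b != s k ->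
  dot (wvec eps gam k b) (vtx eps gam s) < 1.
Proof.
have h : 0 < zval (sbit s) k / zcst eps gam k.
  by rewrite divr_gt0 ?zval_gt0 ?zcst_gt0.
by rewrite dot_wvec_vtx; case: (s k); case: b => // _; rewrite /sgn; lra.
Qed.

Lemma dot_wvec_vtx_le1 (k : 'I_d) b s : dot (wvec eps gam k b) (vtx eps gam s) <= 1.
Proof.
by have [->|/dot_wvec_vtx_lt1/ltW//] := eqVneq b (s k); rewrite dot_wvec_vtx1.
Qed.

(** Row [k] involves no coordinate beyond [k]: the matrix is lower triangular with nonzero
    diagonal. *)
Lemma Wmat_unit L s : L != 0 -> Wmat eps gam L s \in unitmx.
Proof.
move=> L0; rewrite unitmxE det_trig; last first.
  apply/is_trig_mxP => k j kj; rewrite !mxE /=.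
  have [k1 k2] : (k < j.+1)%N /\ (k < j.+2)%N by split; rewrite !ltnS ltnW // ltnW.
  rewrite -val_eqE /= !gtn_eqF //.
  by rewrite !mulr0n !mulr0 addr0 subr0 mul0r mulr0 if_same.
rewrite unitfE; apply/prodf_neq0 => k _; rewrite !mxE /= eqxx !gtn_eqF //.
rewrite !mulr0n mulr1n !mulr0 addr0 subr0 mulr1.
have sz : sgn R (s k) / zcst eps gam k != 0.
  rewrite mulf_neq0 ?invr_eq0 ?(gt_eqF (zcst_gt0 _)) //.
  by case: (s k); rewrite /sgn ?oppr_eq0 oner_eq0.
by case: ifP => _ //; rewrite mulf_neq0.
Qed.

Lemma mul_Wmat L s (a : 'rV[R]_d) :
  a *m Wmat eps gam L s = \sum_k a 0 k *: Pplus eps gam L (k, s k).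
Proof.
rewrite mulmx_sum_row; apply: eq_bigr => k _; congr (_ *: _).
by apply/rowP => j; rewrite !mxE.
Qed.

(** Undoing the stretch leaves a matrix independent of [L], so the dependence of the coefficients on
    [L] sits in the point alone. *)
Lemma scaleL_mul_Wmat L s (a : 'rV[R]_d) : L != 0 ->
  scaleL L^-1 (a *m Wmat eps gam L s) = a *m Wmat eps gam 1 s.
Proof.
move=> L0; rewrite !mul_Wmat scaleL_sum; apply: eq_bigr => k _.
rewrite scaleLK //; congr (_ *: _); apply/rowP => j.
by rewrite !mxE mul1r if_same.
Qed.

Lemma dot_mul_Wmat1 s (a : 'rV[R]_d) x :
  dot (a *m Wmat eps gam 1 s) x = \sum_k a 0 k * dot (wvec eps gam k (s k)) x.
Proof.
rewrite mul_Wmat dot_suml; apply: eq_bigr => k _; rewrite dotZl.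
congr (_ * _); apply: eq_bigr => j _; rewrite !mxE mul1r if_same //.
Qed.

(** * The points p_sigma and q_sigma *)

Hypothesis d_gt1 : (1 < d)%N.
Variable p : {ffun 'I_d -> bool} -> 'rV[R]_d.
Hypothesis p_sol : forall s,
  inS (p s) /\ inDual eps gam (p s) /\
  dot (p s) (vtx eps gam s) = 1 /\
  (forall t, t != s -> dot (p s) (vtx eps gam t) < 1).

(** The two coordinates that [scaleL] leaves alone: [i1] has value [d - 2], [i2] has value
    [d - 1]. *)
Let i1 : 'I_d := Ordinal (etrans (ltn_subrL 2 d) (ltnW d_gt1)).
Let i2 : 'I_d := Ordinal (etrans (ltn_subrL 1 d) (ltnW d_gt1)).

Lemma ord_cases (j : 'I_d) : [\/ (j < d - 2)%N, j = i1 | j = i2].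
Proof.
have [jd|] := ltnP j (d - 2)%N; first by constructor 1.
rewrite leq_eqVlt => /predU1P[e|jd].
  by constructor 2; apply: val_inj; rewrite /= e.
constructor 3; apply/val_inj/eqP; rewrite /= eqn_leq.
have := ltn_ord j; have := d_gt1; lia.
Qed.

Lemma i2_neq_i1 : i2 != i1.
Proof. by rewrite -val_eqE /=; have := d_gt1; lia. Qed.

Lemma i2_ge : (i2 < d - 2)%N = false.
Proof. by have := d_gt1; rewrite /=; lia. Qed.

Lemma i1_ge : (i1 < d - 2)%N = false.
Proof. by rewrite ltnn. Qed.

Lemma dot_inS_last2 (x y : 'rV[R]_d) : inS x -> dot x y = x 0 i1 * y 0 i1 + x 0 i2 * y 0 i2.
Proof.
move=> xS; rewrite /dot (bigD1 i1) //= (bigD1 i2) ?i2_neq_i1 //= big1 ?addr0 //.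
move=> j /andP[/eqP j1 /eqP j2]; have [jd|//|//] := ord_cases j.
by rewrite xS ?mul0r.
Qed.

Lemma vtxE s (k : 'I_d) : vtx eps gam s 0 k = sgn R (s k) * zval (sbit s) k.
Proof. by rewrite mxE -/(vert _ _) vertE sbitE. Qed.

(** This makes [Cc] negative. *)
Lemma p_lt2 s : p s 0 i1 < 2.
Proof.
have [pS [pD _]] := p_sol s.
pose b := 0 <= p s 0 i2.
(* Minus signs before [i1] make the vertex coordinate at [i1] equal to 1, and the sign at [i2]
   agrees with that of [p s]. The dual inequality of [t] then bounds [p s 0 i1] by 1. *)
pose t : {ffun 'I_d -> bool} := [ffun j => (j == i1) || (j == i2) && b].
have t1 : vtx eps gam t 0 i1 = 1.
  rewrite vtxE ffunE eqxx /sgn mul1r vert_allm // => j jd.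
  have jd' : (j < d)%N by apply: ltn_trans jd (ltn_ord i1).
  rewrite (sbitE t (Ordinal jd')) ffunE -!val_eqE /= ltn_eqF //=.
  by rewrite ltn_eqF //=; move: jd => /=; lia.
have t2 : 0 <= p s 0 i2 * vtx eps gam t 0 i2.
  rewrite vtxE ffunE (negPf i2_neq_i1) eqxx /= mulrA pmulr_lge0 ?zval_gt0 //.
  rewrite /b /sgn; case: (leP 0 (p s 0 i2)) => [|/ltW] h; first by rewrite mulr1.
  by rewrite mulrN1 oppr_ge0.
have := pD t; rewrite dotC dot_inS_last2 // t1 mulr1; lra.
Qed.

Lemma adm_bits s : adm s -> s i1 /\ s i2.
Proof. by rewrite /adm (sbitE s i1) (sbitE s i2) => /andP. Qed.

Lemma adm_gt0 s : adm s -> 0 < vtx eps gam s 0 i1 /\ 0 < vtx eps gam s 0 i2.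
Proof. by move=> /adm_bits[h1 h2]; rewrite !vtxE h1 h2 !mul1r !zval_gt0. Qed.

Lemma nrm2_scaled_vtx_gt0 s L : adm s -> 0 < nrm2 (scaleL L (vtx eps gam s)).
Proof.
move=> /adm_gt0[v1 _]; apply: nrm2_gt0; apply/eqP => /rowP/(_ i1).
by rewrite mxE i1_ge [RHS]mxE => e; rewrite e ltxx in v1.
Qed.

Lemma CcE s : Cc eps gam p s =
  (p s 0 i1 - 2) * nrm2 (scaleL 0 (vtx eps gam s)) / vtx eps gam s 0 i1.
Proof. by rewrite /Cc (coordE _ i1) (coordE _ i1) [X in _ / X]mxE i1_ge. Qed.

Lemma Cc_lt0 s : adm s -> Cc eps gam p s < 0.
Proof.
move=> sa; have [v1 _] := adm_gt0 sa.
by rewrite CcE pmulr_llt0 ?invr_gt0 // pmulr_llt0 ?nrm2_scaled_vtx_gt0 // subr_lt0 p_lt2.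
Qed.

Lemma qvE s (j : 'I_d) : qv eps gam p s 0 j =
  if (j < d - 2)%N then 0 else
  p s 0 j - Cc eps gam p s / nrm2 (scaleL 0 (vtx eps gam s)) * vtx eps gam s 0 j.
Proof.
rewrite /qv 4!mxE; case: ifP => // jd; have [pS _] := p_sol s.
by rewrite pS // mul0r mulr0 subr0.
Qed.

Lemma qv_lpt s : adm s -> qv eps gam p s = lpt d (Defs.coord (qv eps gam p s) (d - 1)).
Proof.
move=> sa; apply/rowP => j; rewrite [RHS]mxE; have [jd|->|->] := ord_cases j.
- by rewrite qvE jd !ltn_eqF //; move: jd; lia.
- rewrite qvE i1_ge eqxx CcE.
  have n0 := nrm2_scaled_vtx_gt0 0 sa; have [v1 _] := adm_gt0 sa.
  by field; rewrite !gt_eqF.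
- by rewrite -[_ == (d - 2)%N]/(_ == val i1) (val_eqE i2 i1) (negPf i2_neq_i1) eqxx -(coordE _ i2).
Qed.

(** The value is the same for every [L] because q_sigma lies in the plane of the last two
    coordinates. As [Cc] is negative, q_sigma is strictly beyond the supporting hyperplane. *)
Lemma dot_qv s L : adm s ->
  dot (qv eps gam p s) (scaleL L (vtx eps gam s)) = 1 - Cc eps gam p s.
Proof.
move=> sa; have n0 := nrm2_scaled_vtx_gt0 0 sa; have [pS [_ [p1 _]]] := p_sol s.
have vS : inS (scaleL 0 (vtx eps gam s)) by move=> j jd; rewrite mxE jd mul0r.
rewrite dotBl dotZl !dot_inS // p1 -(dot_inS 0 _ vS) -/(nrm2 _) divfK //.
by rewrite gt_eqF.
Qed.

Lemma dot_pdelta s L : adm s ->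
  dot (pdelta eps gam p L s) (scaleL L^-1 (vtx eps gam s)) = 1.
Proof.
move=> sa; have n0 := nrm2_scaled_vtx_gt0 L^-1 sa.
by rewrite dotDl dotZl dot_qv // divfK ?gt_eqF // addrC subrK.
Qed.

(** * Barycentric coordinates of p_sigma^(delta) *)

Lemma coefs_mulE L s : L != 0 ->
  coefs eps gam p L s *m Wmat eps gam L s = pdelta eps gam p L s.
Proof. by move=> L0; rewrite mulmxKV ?Wmat_unit. Qed.

(** Pairing the combination with v_sigma(delta) gives 1 for the point and 1 for each generator. *)
Lemma coefs_sum L s : L != 0 -> adm s -> \sum_k coefs eps gam p L s 0 k = 1.
Proof.
move=> L0 sa; rewrite -(dot_pdelta L sa) -coefs_mulE // mul_Wmat dot_suml.
apply: eq_bigr => k _; rewrite dotZl dot_scaleL // dot_wvec_vtx1 mulr1 //.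
Qed.

Lemma base_coefs_gt0 s k : 0 < (p s *m invmx (Wmat eps gam 1 s)) 0 k.
Proof.
have [_ [_ [p1 plt]]] := p_sol s; set c := _ *m _.
have cE : c *m Wmat eps gam 1 s = p s by rewrite mulmxKV ?Wmat_unit ?oner_eq0.
(* Tightness depends on the signs only, so at [t] every facet of [s] but that of index [k] stays
   tight, and a single term survives in the comparison. *)
pose t : {ffun 'I_d -> bool} := [ffun i => s i (+) (i == k)].
have tk : s k != t k by rewrite ffunE eqxx; case: (s k).
have ts : t != s by apply: contra tk => /eqP ->.
have : dot (p s) (vtx eps gam t) < dot (p s) (vtx eps gam s) by rewrite p1 plt.
rewrite -cE !dot_mul_Wmat1 -subr_lt0 -sumrB (bigD1 k) //= big1 => [|i ik].
  rewrite addr0 -mulrBr dot_wvec_vtx1 nmulr_llt0 // subr_lt0.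
  exact: dot_wvec_vtx_lt1.
have -> : s i = t i by rewrite ffunE (negPf ik) addbF.
by rewrite dot_wvec_vtx1 ffunE (negPf ik) addbF dot_wvec_vtx1 subrr.
Qed.

Lemma nrm2_scaleL L (x : 'rV[R]_d) : nrm2 (scaleL L x) =
  nrm2 (scaleL 0 x) + L ^+ 2 * \sum_(j < d | (j < d - 2)%N) x 0 j ^+ 2.
Proof.
rewrite mulr_sumr [X in _ + X]big_mkcond -big_split; apply: eq_bigr => j _ /=.
by rewrite !mxE; case: ifP => _; ring.
Qed.

(* Multiplied by the squared norm of v_sigma(delta), the coefficients are affine
   in delta^2, with the positive constant term given by base_coefs_gt0. *)
Lemma coefs_gt0_small s : adm s ->
  exists2 d0, 0 < d0 & forall e, 0 < e < d0 -> forall k, 0 < coefs eps gam p e^-1 s 0 k.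
Proof.
move=> sa; pose v := vtx eps gam s.
pose N0 := nrm2 (scaleL 0 v); pose N1 := \sum_(j < d | (j < d - 2)%N) v 0 j ^+ 2.
pose W' := invmx (Wmat eps gam 1 s).
(* The part of order [e ^+ 2]: the first coordinates carry [e] twice, from v_sigma(e) and from
   undoing the stretch; the last two get it from the squared norm [N0 + e ^+ 2 * N1]. *)
pose u : 'rV[R]_d := \row_j if (j < d - 2)%N then Cc eps gam p s * v 0 j
                            else qv eps gam p s 0 j * N1.
have N0_gt0 : 0 < N0 by apply: nrm2_scaled_vtx_gt0.
apply: small_forall => k.
have [d0 d0_gt0 hd] := small_sqr_pos ((u *m W') 0 k) (mulr_gt0 N0_gt0 (base_coefs_gt0 s k)).
exists d0 => // e he; have e0 : e^-1 != 0 by rewrite invr_eq0 gt_eqF //; case/andP: he.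
have N_gt0 := nrm2_scaled_vtx_gt0 e sa.
rewrite -(pmulr_rgt0 _ N_gt0); move: (hd e he); congr (0 < _).
have cE : coefs eps gam p e^-1 s = scaleL e (pdelta eps gam p e^-1 s) *m W'.
  by rewrite -[e in scaleL e]invrK -(coefs_mulE _ e0) scaleL_mul_Wmat // mulmxK ?Wmat_unit ?oner_eq0.
have vE : nrm2 (scaleL e v) *: scaleL e (pdelta eps gam p e^-1 s) = N0 *: p s + e ^+ 2 *: u.
  have [pS _] := p_sol s.
  rewrite /u /pdelta invrK; have := qvE s; move: (qv eps gam p s) => q.
  rewrite -/v -/N0 in N_gt0 * => qE; clearbody v.
  apply/rowP => j; rewrite !mxE qE; case: ifP => jd.
    by rewrite jd pS //; field; rewrite gt_eqF.
  rewrite jd (nrm2_scaleL e) -/N0 -/N1; field.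
  by rewrite /N0 /N1 -nrm2_scaleL !gt_eqF.
rewrite cE; have := congr1 (fun x => (x *m W') 0 k) vE.
by rewrite /= -scalemxAl mulmxDl -!scalemxAl !mxE => ->.
Qed.

(** * Bounds on mubar and mu for a fixed scaling *)

Variable L : R.
Hypothesis L_gt0 : 0 < L.
(** From here on the smallness of delta enters only in this form. *)
Hypothesis coefs_gt0 : forall s, adm s -> forall k, 0 < coefs eps gam p L s 0 k.

Let L_neq0 : L != 0. Proof. by rewrite gt_eqF. Qed.

Local Notation vd s := (scaleL L^-1 (vtx eps gam s)).
Local Notation q s := (qv eps gam p s).
Local Notation qy s := (Defs.coord (qv eps gam p s) (d - 1)).

Lemma coefs_lt1 s k : adm s -> coefs eps gam p L s 0 k < 1.
Proof.
move=> sa; rewrite -(coefs_sum L_neq0 sa) (bigD1 k) //= ltrDl.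
have [j jk] : exists j : 'I_d, j != k.
  by have [->|] := eqVneq k i1; [exists i2; exact: i2_neq_i1 | exists i1; rewrite eq_sym].
rewrite (bigD1 j) //= ltr_wpDr ?coefs_gt0 //.
by apply: sumr_ge0 => i _; rewrite ltW ?coefs_gt0.
Qed.

Lemma mubar_lt1 : mubar eps gam p L < 1.
Proof.
rewrite /mubar gt_max; apply/andP; split; first by lra.
by apply: bigmax_lt => // s sa; apply: bigmax_lt => // k _; apply: coefs_lt1.
Qed.

Lemma mubar_ge_half : 1 / 2 <= mubar eps gam p L.
Proof. by rewrite le_max lexx. Qed.

Lemma coefs_le_mubar s k : adm s -> coefs eps gam p L s 0 k <= mubar eps gam p L.
Proof.
move=> sa; rewrite le_max; apply/orP; right.
apply: le_trans (le_bigmax_cond _ _ sa); exact: le_bigmax_cond.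
Qed.

Lemma qmin_le s : adm s -> qmin eps gam p <= qy s.
Proof. by move=> sa; apply: bigmin_le_cond. Qed.

Lemma qmax_ge s : adm s -> qy s <= qmax eps gam p.
Proof. by move=> sa; exact: (le_bigmax_cond _ (fun s => qy s)). Qed.

Lemma muq_bounds s : adm s ->
  mubar eps gam p L <= muq eps gam p L (q s) <= 1.
Proof.
move=> sa; have h1 := qmin_le sa; have h2 := qmax_ge sa; have m1 := mubar_lt1.
rewrite /muq mulrAC.
set r := (_ / _); suff /andP[r0 r1] : 0 <= r <= 1 by nra.
rewrite /r divr_ge0 ?subr_ge0 ?(le_trans h1) //=.
(* If [qmax] equals [qmin], the inverse is 0 by convention, the ratio is 0 and [muq] is 1. *)
have [->|D0] := eqVneq (qmax eps gam p - qmin eps gam p) 0; first by rewrite invr0 mulr0.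
by rewrite ler_pdivrMr ?mul1r ?lerD2r // lt_neqAle eq_sym D0 subr_ge0 (le_trans h1).
Qed.

Lemma sum_facets (V : zmodType) s (F : 'I_d * bool -> V) :
  \sum_i F i = \sum_k (F (k, s k) + F (k, ~~ s k)).
Proof.
transitivity (\sum_k \sum_b F (k, b)); first by rewrite pair_bigA; apply: eq_bigr => -[].
by apply: eq_bigr => k _; rewrite big_bool; case: (s k) => //=; rewrite addrC.
Qed.

(** * The reduced convex hulls of both classes *)

Lemma pdelta_convmu s : adm s ->
  convmu (muq eps gam p L (q s)) (Pplus eps gam L) (pdelta eps gam p L s).
Proof.
move=> sa; have /andP[hm _] := muq_bounds sa.
exists (fun i => if i.2 == s i.1 then coefs eps gam p L s 0 i.1 else 0); split=> [i|].
  case: ifP => _; first by rewrite ltW ?coefs_gt0 //= (le_trans _ hm) ?coefs_le_mubar.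
  by have := mubar_ge_half; lra.
split.
  rewrite (sum_facets s) -(coefs_sum L_neq0 sa); apply: eq_bigr => k _ /=.
  by rewrite eqxx; case: (s k); rewrite addr0.
rewrite -coefs_mulE // mul_Wmat (sum_facets s); apply: eq_bigr => k _ /=.
by rewrite eqxx; case: (s k); rewrite scale0r addr0.
Qed.

Lemma Pminus_mix (a : bool -> R) : \sum_b a b = 1 ->
  \sum_b a b *: Pminus eps gam p L b =
  lpt d (qmin eps gam p + a true *
    ((qmax eps gam p - qmin eps gam p) / (1 - mubar eps gam p L))).
Proof.
rewrite !big_bool /= => a1; apply/rowP => j; rewrite !mxE.
have -> : a false = 1 - a true by rewrite -a1; ring.
by case: ifP => _; [|case: ifP => _]; ring.
Qed.

Lemma qv_convmu s : adm s ->
  convmu (muq eps gam p L (q s)) (Pminus eps gam p L) (q s).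
Proof.
move=> sa; have /andP[hm h1] := muq_bounds sa; have m2 := mubar_ge_half.
set mu := muq _ _ _ _ _ in hm h1 *.
(* The left point gets the full cap [mu]; [mu >= 1 / 2] keeps the rest, [1 - mu], below the cap. *)
exists (fun b : bool => if b then 1 - mu else mu); split=> [b|].
  by apply/andP; case: b; split; lra.
split; first by rewrite big_bool /=; ring.
rewrite Pminus_mix; last by rewrite big_bool /=; ring.
rewrite {1}qv_lpt //; congr lpt; rewrite /mu /muq.
have m1 := mubar_lt1; have y1 := qmin_le sa; have y2 := qmax_ge sa.
have [D0|D0] := eqVneq (qmax eps gam p - qmin eps gam p) 0.
  by rewrite D0 mul0r mulr0 addr0; lra.
by field; rewrite D0 andbT; lra.
Qed.

(** The cap on the left point forces weight at least [1 - mu] on the right one, and exactly this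
    weight yields q_sigma. *)
Lemma convmu_Pminus s qq : adm s ->
  convmu (muq eps gam p L (q s)) (Pminus eps gam p L) qq ->
  exists2 y, qy s <= y & qq = lpt d y.
Proof.
move=> sa [a [ha [a1 ->]]]; rewrite Pminus_mix //.
eexists; last by [].
have m1 := mubar_lt1; have y1 := qmin_le sa; have y2 := qmax_ge sa.
have ta : 1 - muq eps gam p L (q s) <= a true.
  by have /andP[_] := ha false; move: a1; rewrite big_bool /=; lra.
have [D0|D0] := eqVneq (qmax eps gam p - qmin eps gam p) 0.
  by rewrite D0 mul0r mulr0 addr0; lra.
have D1 : 0 < qmax eps gam p - qmin eps gam p.
  by rewrite lt_neqAle eq_sym D0 subr_ge0 (le_trans y1).
have m0 : 0 < 1 - mubar eps gam p L by rewrite subr_gt0.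
rewrite -lerBlDl mulrA ler_pdivlMr // -ler_pdivrMr //.
by apply: le_trans ta; rewrite /muq; lra.
Qed.

Lemma dot_lptB y y' (x : 'rV[R]_d) : dot (lpt d y - lpt d y') x = (y - y') * x 0 i2.
Proof.
have e2 : (i2 == d - 2 :> nat)%N = false by apply/negbTE: i2_neq_i1.
rewrite /dot (bigD1 i2) //= big1 ?addr0 => [|j /eqP j2].
  by rewrite !mxE e2 eqxx.
rewrite !mxE; case: ifP => _; first by rewrite subrr mul0r.
case: eqP => e; last by rewrite subrr mul0r.
by case: j2; apply: val_inj.
Qed.

(** * Uniqueness of the primal optimum *)

Lemma dot_Pplus_vd s i : dot (Pplus eps gam L i) (vd s) =
  dot (wvec eps gam i.1 i.2) (vtx eps gam s).
Proof. exact: dot_scaleL. Qed.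

Lemma convmu_Pplus mu pp s : convmu mu (Pplus eps gam L) pp -> dot pp (vd s) <= 1.
Proof.
move=> [a [ha [a1 ->]]]; rewrite -a1 dot_suml; apply: ler_sum => i _.
rewrite dotZl dot_Pplus_vd ler_piMr ?dot_wvec_vtx_le1 //.
by case/andP: (ha i).
Qed.

Lemma svm_unique s pp qq : adm s ->
  convmu (muq eps gam p L (q s)) (Pplus eps gam L) pp ->
  convmu (muq eps gam p L (q s)) (Pminus eps gam p L) qq ->
  (pp, qq) <> (pdelta eps gam p L s, q s) ->
  nrm2 (pdelta eps gam p L s - q s) < nrm2 (pp - qq).
Proof.
move=> sa hpp hqq neq.
have [y yq qqE] := convmu_Pminus sa hqq.
have p1 := convmu_Pplus s hpp; have [_ v2] := adm_gt0 sa.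
have n0 := nrm2_scaled_vtx_gt0 L^-1 sa.
have c0 := Cc_lt0 sa.
have qqv : dot qq (vd s) = 1 - Cc eps gam p s + (y - qy s) * vtx eps gam s 0 i2.
  have -> : qq = q s + (lpt d y - lpt d (qy s)) by rewrite -qv_lpt // qqE addrC subrK.
  by rewrite dotDl dot_qv // dot_lptB mxE i2_ge.
have yv : 0 <= (y - qy s) * vtx eps gam s 0 i2 by rewrite mulr_ge0 ?(ltW v2) ?subr_ge0.
have -> : pdelta eps gam p L s - q s = (Cc eps gam p s / nrm2 (vd s)) *: vd s.
  by rewrite /pdelta addrK.
apply: nrm2_halfspace; first by rewrite pmulr_llt0 ?invr_gt0.
  by rewrite dotBl divfK ?gt_eqF //; lra.
(* If the difference is the vector of least norm, both estimates are equalities. The positive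
   coordinate at [i2] then forces [y] to be that of q_sigma, which determines [qq] and hence
   [pp]. *)
apply/eqP => e; apply: neq.
have : dot (pp - qq) (vd s) = Cc eps gam p s by rewrite e dotZl divfK ?gt_eqF.
rewrite dotBl qqv => e1.
have yv0 : (y - qy s) * vtx eps gam s 0 i2 = 0 by lra.
have yE : y = qy s.
  by apply/eqP; move/eqP: yv0; rewrite mulf_eq0 (gt_eqF v2) orbF subr_eq0.
have qE : qq = q s by rewrite qqE yE -qv_lpt.
by rewrite -qE; congr pair; rewrite /pdelta -e -qE subrK.
Qed.

(** * The dual problem and its support vectors *)

Lemma dobjE (a : ('I_d * bool) + bool -> R) : dobj eps gam p L a =
  nrm2 (\sum_i a (inl i) *: Pplus eps gam L i - \sum_b a (inr b) *: Pminus eps gam p L b).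
Proof.
transitivity (nrm2 (\sum_i (a i * dlab R i) *: dpt eps gam p L i)).
  rewrite /nrm2 dot_suml; apply: eq_bigr => i _.
  rewrite dotZl dotC dot_suml mulr_sumr; apply: eq_bigr => j _.
  by rewrite dotZl [dot (dpt _ _ _ _ j) _]dotC; ring.
rewrite big_sumType /= -sumrN; congr (nrm2 (_ + _)); apply: eq_bigr => i _.
  by rewrite mulr1.
by rewrite mulrN1 scaleNr.
Qed.

Lemma dfeasE mu (a : ('I_d * bool) + bool -> R) : dfeas mu a <->
  [/\ \sum_i a (inl i) = 1, \sum_b a (inr b) = 1 & forall i, 0 <= a i <= mu].
Proof.
have n1 : (-1 == 1 :> R) = false by apply/negbTE/eqP => h; lra.
rewrite /dfeas !big_sumType /= !(eq_sym 1) n1 !eqxx !big_pred0_eq addr0 add0r.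
by split=> [[? []]|[]].
Qed.

Lemma dfeas_convmu mu (a : ('I_d * bool) + bool -> R) : dfeas mu a ->
  convmu mu (Pplus eps gam L) (\sum_i a (inl i) *: Pplus eps gam L i) /\
  convmu mu (Pminus eps gam p L) (\sum_b a (inr b) *: Pminus eps gam p L b).
Proof. 
case/dfeasE => a1 a2 ha.
by split; [exists (fun i => a (inl i)) | exists (fun b => a (inr b))]; split.
 Qed.

Lemma dual_witness s : adm s ->
  exists2 a, dfeas (muq eps gam p L (q s)) a &
    dobj eps gam p L a = nrm2 (pdelta eps gam p L s - q s).
Proof.
move=> sa; have [a [ha [a1 aE]]] := pdelta_convmu sa.
have [b [hb [b1 bE]]] := qv_convmu sa.
pose c (i : ('I_d * bool) + bool) := match i with inl i => a i | inr i => b i end.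
exists c; first by apply/dfeasE; split=> // -[].
by rewrite dobjE -aE -bE.
Qed.

Lemma dual_opt_exists s : adm s ->
  exists a, dopt eps gam p L (muq eps gam p L (q s)) a.
Proof.
move=> sa; have [a fa aE] := dual_witness sa; exists a; split=> // b fb.
have [hp hq] := dfeas_convmu fb; rewrite aE dobjE.
set pp := (\sum_i _) in hp *; set qq := (\sum_b _) in hq *.
have [[-> ->] //|/eqP neq] := eqVneq (pp, qq) (pdelta eps gam p L s, q s).
exact/ltW/svm_unique.
Qed.

(** The combinations given by [a] form a feasible primal pair at no more than the optimal distance,
    so primal uniqueness applies. *)
Lemma dual_opt_points s a : adm s -> dopt eps gam p L (muq eps gam p L (q s)) a ->
  \sum_i a (inl i) *: Pplus eps gam L i = pdelta eps gam p L s.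
Proof.
move=> sa [fa amin]; have [b fb bE] := dual_witness sa.
have [hp hq] := dfeas_convmu fa; have := amin b fb; rewrite bE dobjE.
set pp := (\sum_i _) in hp *; set qq := (\sum_b _) in hq *.
have [[-> _] //|/eqP neq] := eqVneq (pp, qq) (pdelta eps gam p L s, q s).
by rewrite leNgt svm_unique.
Qed.

Lemma dual_opt_support s a k b : adm s ->
  dopt eps gam p L (muq eps gam p L (q s)) a ->
  0 < a (inl (k, b)) <-> b = s k.
Proof.
move=> sa oa; have aE := dual_opt_points sa oa.
have [/dfeasE[a1 _ ha] _] := oa.
(* Complementary slackness: nonnegative terms with sum [1 - 1] all vanish, so a facet that is not
   tight has weight 0. *)
have slack0 : \sum_i a (inl i) * (1 - dot (Pplus eps gam L i) (vd s)) = 0.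
  under eq_bigr do rewrite mulrBr mulr1 -dotZl.
  by rewrite sumrB a1 -dot_suml aE dot_pdelta ?subrr.
have slack_ge0 i : true -> 0 <= a (inl i) * (1 - dot (Pplus eps gam L i) (vd s)).
  move=> _; rewrite mulr_ge0 ?subr_ge0 ?dot_Pplus_vd ?dot_wvec_vtx_le1 //.
  by case/andP: (ha (inl i)).
have off i : i.2 != s i.1 -> a (inl i) = 0.
  move=> ib; have /eqP := psumr_eq0P slack_ge0 slack0 (i := i) isT.
  rewrite mulf_eq0 subr_eq0 dot_Pplus_vd.
  by rewrite (gt_eqF (dot_wvec_vtx_lt1 ib)) orbF => /eqP.
(* The remaining weights represent the same point by the rows of an invertible matrix, hence equal
   [coefs]. *)
have on j : a (inl (j, s j)) = coefs eps gam p L s 0 j.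
  have cE : (\row_i a (inl (i, s i))) *m Wmat eps gam L s = pdelta eps gam p L s.
    rewrite mul_Wmat -aE (sum_facets s); apply: eq_bigr => i _.
    by rewrite mxE (off (i, ~~ s i)) ?scale0r ?addr0 //=; case: (s i).
  by rewrite /coefs -cE mulmxK ?Wmat_unit // mxE.
split=> [|->]; last by rewrite on coefs_gt0.
by have [//|bk] := eqVneq b (s k); rewrite (off (k, b)) // ltxx.
Qed.

(** A generator common to both sets is tight at the vertex of [t], which fails for a facet whose
    sign differs from that of [t]. *)
Lemma svset_inj s t : svset eps gam L s = svset eps gam L t -> s = t.
Proof.
move=> e; apply/ffunP => k.
have : svset eps gam L s (Pplus eps gam L (k, s k)) by exists k.
rewrite e => -[j jE]; apply/eqP; apply: contraT => /(dot_wvec_vtx_lt1 (k := k)).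
by rewrite -(dot_Pplus_vd t (k, s k)) jE dot_Pplus_vd dot_wvec_vtx1 ltxx.
Qed.

End Goldfarb.

(** * Choice of the threshold and assembly *)

Theorem theorem3 (R : realType) (d : nat) (eps gam : R)
  (p : {ffun 'I_d -> bool} -> 'rV[R]_d) :
  (3 <= d)%N -> 0 < 4 * gam -> 4 * gam < eps -> eps < 1 / 2 ->
  (forall s : {ffun 'I_d -> bool},
     inS (p s) /\ inDual eps gam (p s) /\
     dot (p s) (vtx eps gam s) = 1 /\
     (forall t : {ffun 'I_d -> bool}, t != s -> dot (p s) (vtx eps gam t) < 1)) ->
  forall s : {ffun 'I_d -> bool}, adm s ->
  exists delta0 : R, 0 < delta0 /\
  forall delta : R, 0 < delta < delta0 ->
    let L := delta^-1 in
    let mu := muq eps gam p L (qv eps gam p s) in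
    (* (i) *)
    (convmu mu (Pplus eps gam L) (pdelta eps gam p L s) /\
     convmu mu (Pminus eps gam p L) (qv eps gam p s) /\
     (forall pp qq : 'rV[R]_d,
        convmu mu (Pplus eps gam L) pp ->
        convmu mu (Pminus eps gam p L) qq ->
        (pp, qq) <> (pdelta eps gam p L s, qv eps gam p s) ->
        nrm2 (pdelta eps gam p L s - qv eps gam p s) < nrm2 (pp - qq))) /\
    (* (ii) *)
    ((exists a, dopt eps gam p L mu a) /\
     (forall a, dopt eps gam p L mu a ->
        forall (k : 'I_d) (b : bool), 0 < a (inl (k, b)) <-> b = s k)) /\
    (forall s' : {ffun 'I_d -> bool}, adm s' -> s' != s ->
        svset eps gam L s <> svset eps gam L s').
Proof.
move=> d3 g0 ge e2 hp s sa; have d2 := ltnW d3.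
(* One threshold has to serve all admissible [t] at once, since [mubar] is a maximum over all of
   them. *)
have [d0 d0_gt0 hd] : exists2 d0 : R, 0 < d0 & forall e, 0 < e < d0 ->
    forall t : {ffun 'I_d -> bool}, adm t -> forall k, 0 < coefs eps gam p e^-1 t 0 k.
  apply: small_forall => t; have [ta|_] := boolP (adm t); last by exists 1.
  have [d0 d0_gt0 hd] := coefs_gt0_small g0 ge e2 d2 hp ta.
  by exists d0 => // e he _; apply: hd.
exists d0; split=> // delta hdelta L mu.
have L0 : 0 < L by rewrite invr_gt0; case/andP: hdelta.
have c0 := hd _ hdelta.
split; first (split; last split).
- exact: pdelta_convmu.
- exact: qv_convmu.
- by move=> pp qq; apply: svm_unique.
split; first split.
- exact: dual_opt_exists.
- by move=> a oa k b; apply: (dual_opt_support g0 ge e2 d2 hp L0 c0).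
by move=> t _ ts /(svset_inj g0 ge e2 L0) st; rewrite st eqxx in ts.
Qed.
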